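(* Let $(V,\mu)$ and $(E,\tau)$ be positive measure spaces, $M:V\times E\to\mathbb{R}$ a $(\mu\times\tau)$-measurable function, $wt:E\to\mathbb{R}$ a $\tau$-measurable function, $I\subseteq\mathbb{R}$ an interval, and $\varphi:I\to\mathbb{R}$ a function such that $f(t)=t\varphi(t)$ is convex on $I$. Let $E_0\subseteq E$ be a measurable subset (the erased coordinates) and define $$wt_{E_0}(e)=\begin{cases}0,&e\in E_0,\\ wt(e),&e\in E\setminus E_0.\end{cases}$$ Suppose that: (i) $0<\mu(V)<\infty$; (ii) $0<s_{E_0}:=\int_E wt_{E_0}\,d\tau<\infty$; (iii) $\int_{V\times E}|M(v,e)|\,|wt_{E_0}(e)|\,d(\mu\times\tau)<\infty$; (iv) for some real number $c$, $\int_V M(v,e)\,d\mu(v)=c$ for $\tau$-almost all $e\in E$; (v) for $\mu$-almost all $v\in V$, $\delta_{E_0}(v):=\int_E M(v,e)\,wt_{E_0}(e)\,d\tau(e)\in I$; (vi) $\int_{V\times E}|\varphi(\delta_{E_0}(v))|\,|M(v,e)|\,|wt_{E_0}(e)|\,d(\mu\times\tau)<\infty$. Let $\bar\delta_{E_0}=\frac{1}{\mu(V)}\int_V\delta_{E_0}(v)\,d\mu(v)$. Then $$\frac{1}{s_{E_0}}\int_{V\times E}\varphi(\delta_{E_0}(v))\,M(v,e)\,wt_{E_0}(e)\,d(\mu\times\tau)\;\ge\;c\,\varphi(\bar\delta_{E_0}).$$ Moreover, if $f$ is strictly convex on $I$, then equality holds if and only if $\delta_{E_0}(v)$ is constant for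 $\mu$-a.e. $v\in V$.
   Context: $\mu\times\tau$ denotes the product measure on $V\times E$. *)

(* Defs.v *)
From HB Require Import structures.
From mathcomp Require Import all_boot all_order all_algebra.
From mathcomp Require Import all_classical all_reals all_analysis.

Set Implicit Arguments.
Unset Strict Implicit.
Unset Printing Implicit Defensive.

Import Order.TTheory GRing.Theory Num.Theory.
Import numFieldNormedType.Exports.

Local Open Scope classical_set_scope.
Local Open Scope ring_scope.

(* The spaces are not assumed sigma-finite, and then the library's [mu \x tau]
   need not be a measure.  A product of [mu] and [tau] is therefore any measure
   on the product sigma-algebra with the right values on measurable rectangles
   (with 0 * +oo = 0).  It is unique when both measures are sigma-finite, in
   which case it is [mu \x tau]. *)
Definition is_product_measure (d1 d2 : measure_display)
    (V : measurableType d1) (E : measurableType d2) (R : realType)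
    (mu : {measure set V -> \bar R}) (tau : {measure set E -> \bar R})
    (m : {measure set (V * E)%type -> \bar R}) : Prop :=
  forall (A : set V) (B : set E), measurable A -> measurable B ->
    m (A `*` B) = (mu A * tau B)%E.

Lemma product_measure1_is_product (d1 d2 : measure_display)
    (V : measurableType d1) (E : measurableType d2) (R : realType)
    (mu : {measure set V -> \bar R})
    (tau : {sigma_finite_measure set E -> \bar R}) :
  is_product_measure mu tau (mu \x tau)%E.
Proof. by move=> A B mA mB; exact: product_measure1E. Qed.

Definition strictly_convex_function (R : realType) (D : set R) (f : R -> R) :
    Prop :=
  forall x y t : R, D x -> D y -> x != y -> 0 < t < 1 ->
    f (t * x + (1 - t) * y) < t * f x + (1 - t) * f y.

Definition erase (T : Type) (R : realType) (E0 : set T) (wt : T -> R) (e : T) :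
    R :=
  if e \in E0 then 0 else wt e.

(* Real-valued: [Rintegral] returns 0 at the points v where the integral is
   infinite; these form a null set as soon as |M(v, e)| |w(e)| is integrable
   over the product. *)
Definition delta (d1 d2 : measure_display)
    (V : measurableType d1) (E : measurableType d2) (R : realType)
    (tau : {measure set E -> \bar R}) (M : V * E -> R) (w : E -> R) (v : V) :
    R :=
  \int[tau]_(e in setT) (M (v, e) * w e).

Definition mean (d : measure_display) (V : measurableType d) (R : realType)
    (mu : {measure set V -> \bar R}) (g : V -> R) : R :=
  (fine (mu setT))^-1 * \int[mu]_(v in setT) g v.

(* Main.v *)
(* By Fubini, the double integral on the left is the integral over V of
   f(delta), and the integral of delta over V is c s, so that the mean m of
   delta is c s / mu(V) and the claim is Jensen's inequality for f and delta,
   multiplied by mu(V) / s.  If delta is not a.e. equal to m, then it takes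
   values of I on both sides of m, so f has a supporting line at m even though
   I is arbitrary; under strict convexity the line meets the graph only at m.

   The measure tau need not be sigma-finite, but the
   integrability of the weight makes it so on the support of the weight, and
   there the given product measure is the product measure of the library.
   Outside I the function phi is arbitrary, so phi(delta) is measurable only
   after a modification on a null set, which leaves the integrals unchanged even
   though the integrands are not measurable. *)
Require Import Defs.
From HB Require Import structures.
From mathcomp Require Import all_boot all_order all_algebra.
From mathcomp Require Import all_classical all_reals all_analysis.
From mathcomp Require Import measurable_realfun ring lra.

Set Implicit Arguments.
Unset Strict Implicit.
Unset Printing Implicit Defensive.

Import Order.TTheory GRing.Theory Num.Theory.
Import numFieldNormedType.Exports.

Local Open Scope classical_set_scope.
Local Open Scope ring_scope.

(** * Convex functions on an interval: measurability and supporting lines *)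

Lemma convex_functionP (R : realType) (I : set R) (f : R -> R) :
  convex_function I f -> forall x y t : R, I x -> I y -> 0 <= t <= 1 ->
    f (t * x + (1 - t) * y) <= t * f x + (1 - t) * f y.
Proof.
move=> cf x y t Ix Iy /andP[t0 t1].
by have := cf (Itv01 t0 t1) x y (mem_set Ix) (mem_set Iy).
Qed.

(** Convexity with weight [(y - z) / (y - x)], cleared of denominators for use by [nra]. *)
Lemma convex_between (R : realType) (I : set R) (f : R -> R) (x z y : R) :
  convex_function I f -> I x -> I y -> x < z < y ->
  (y - x) * f z <= (y - z) * f x + (z - x) * f y.
Proof.
move=> cf Ix Iy /andP[xz zy].
have yx : 0 < y - x by lra.
have t01 : 0 <= (y - z) / (y - x) <= 1.
  by rewrite divr_ge0 ?ler_pdivrMr //=; lra.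
have := convex_functionP cf Ix Iy t01.
have -> : (y - z) / (y - x) * x + (1 - (y - z) / (y - x)) * y = z.
  by field; rewrite gt_eqF.
rewrite -(ler_pM2l yx) => /le_trans; apply.
rewrite le_eqVlt; apply/orP; left; apply/eqP; field.
by rewrite gt_eqF.
Qed.

(** Sublevel sets of [f] in [I] are intervals, hence measurable. This also covers jumps at the
    endpoints of [I]. *)
Lemma convex_measurable (R : realType) (I : set R) (f : R -> R) :
  is_interval I -> convex_function I f -> measurable_fun I f.
Proof.
move=> itvI cf mI; apply: (measurability _ (RGenOInfty.measurableE R)) => //.
move=> /= _ [_ [r ->] <-].
have -> : I `&` f @^-1` `]r, +oo[ = I `\` [set x | I x /\ f x <= r].
  apply/seteqP; split => x /=; rewrite in_itv/= andbT.
    by move=> [Ix rf]; split => // -[_]; rewrite leNgt rf.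
  by move=> [Ix H]; split => //; rewrite ltNge; apply/negP => fr; apply: H.
apply: measurableD => //; apply: is_interval_measurable.
move=> x y [Ix fx] [Iy fy] z /andP[xz zy]; split.
  by apply: (itvI x y) => //; rewrite xz.
move: xz; rewrite le_eqVlt => /predU1P[<-//|xz].
move: zy; rewrite le_eqVlt => /predU1P[->//|zy].
have xzy : x < z < y by rewrite xz.
have := convex_between cf Ix Iy xzy.
move=> H; have : (y - x) * f z <= (y - x) * r by nra.
by rewrite ler_pM2l//; lra.
Qed.

Lemma measurable_inv (R : realType) : measurable_fun [set: R] (@GRing.inv R).
Proof.
(* The square makes the base of the real power nonnegative; at 0 both sides vanish because
   [0^-1 = 0]. *)
have -> : @GRing.inv R = (fun x => x * (x ^+ 2) `^ (-1)).
  apply/funext => x; rewrite powR_inv1 ?sqr_ge0//.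
  have [->|x0] := eqVneq x 0; first by rewrite invr0 mul0r.
  by field.
apply: measurable_funM => //.
exact (measurableT_comp (measurable_powR _) (@exprn_measurable R setT 2)).
Qed.

Lemma measurable_of_idM (R : realType) (I : set R) (phi : R -> R) :
  measurable I -> measurable_fun I (fun t => t * phi t) ->
  measurable_fun I phi.
Proof.
move=> mI mf.
(* The quotient by [t] loses only the value at 0, which the indicator restores. *)
have -> : phi = (fun t => (t * phi t) * t^-1 + phi 0 * \1_[set 0] t).
  apply/funext => t; rewrite indicE in_set1.
  have [->|t0] := eqVneq t 0; first by rewrite mul0r mul0r add0r mulr1.
  by rewrite mulr0 addr0 mulrAC mulfV ?mul1r.
apply: measurable_funD; apply: measurable_funM => //.
exact: measurable_funTS (@measurable_inv R).
Qed.

(** The slope is the supremum of the secant slopes to the left of [m]; each secant slope to the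
    right bounds them above. The points [x] and [y] make the supremum exist. *)
Lemma convex_supporting_line (R : realType) (I : set R) (f : R -> R)
    (x m y : R) :
  is_interval I -> convex_function I f -> I x -> I y -> x < m < y ->
  exists a : R, forall t, I t -> f m + a * (t - m) <= f t.
Proof.
move=> itvI cf Ix Iy /andP[xm my].
have Im : I m by apply: (itvI x y) => //; rewrite !ltW.
pose A := [set ((f m - f u) / (m - u))%R | u in [set u | I u /\ u < m]].
have A0 : A !=set0 by exists ((f m - f x) / (m - x)), x.
have Aub t : I t -> m < t -> ubound A ((f t - f m) / (t - m)).
  move=> It mt _ [u [Iu um] <-].
  have umt : u < m < t by rewrite um.
  have := convex_between cf Iu It umt => H.
  rewrite ler_pdivrMr ?subr_gt0// mulrAC ler_pdivlMr ?subr_gt0//.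
  nra.
have hA : has_sup A by split => //; exists ((f y - f m) / (y - m)); exact: Aub.
exists (sup A) => t It; have [tm|mt|->] := ltgtP t m.
- have : (f m - f t) / (m - t) <= sup A.
    by apply: ub_le_sup; [exact: hA.2|exists t].
  rewrite ler_pdivrMr ?subr_gt0//; lra.
- have : sup A <= (f t - f m) / (t - m) by apply: ge_sup => //; exact: Aub.
  rewrite ler_pdivlMr ?subr_gt0//; lra.
- by rewrite subrr mulr0 addr0.
Qed.

(** * Integrals and null sets *)

Section almost_everywhere.
Context d (T : measurableType d) (R : realType).
Variable mu : {measure set T -> \bar R}.
Implicit Types f g u : T -> R.

Import HBNNSimple.

Lemma ae_eq_integrable (f g : T -> \bar R) :
  mu.-integrable setT f -> measurable_fun setT g ->
  {ae mu, forall x, f x = g x} -> mu.-integrable setT g.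
Proof.
move=> /integrableP[mf fy] mg fg; apply/integrableP; split => //.
rewrite -(ae_eq_integral (fun x => `|g x|%E) (fun x => `|f x|%E))//.
- exact: measurableT_comp.
- exact: measurableT_comp.
- by apply: filterS fg => x -> _.
Qed.

Lemma ae_eq_Rintegral f g :
  measurable_fun setT f -> measurable_fun setT g ->
  {ae mu, forall x, f x = g x} -> \int[mu]_x f x = \int[mu]_x g x.
Proof.
move=> mf mg fg; congr fine; apply: ae_eq_integral => //.
- exact/measurable_EFinP.
- exact/measurable_EFinP.
- by apply: filterS fg => x -> _.
Qed.

Lemma ae_eq0_Rintegral u : mu.-integrable setT (EFin \o u) ->
  {ae mu, forall x, 0 <= u x} -> \int[mu]_x u x = 0 ->
  {ae mu, forall x, u x = 0}.
Proof.
move=> iu u0 intu; have mu' := measurable_int _ iu.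
have : ae_eq mu setT (EFin \o u) (cst 0%E).
  apply/ae_eq_integral_abs => //.
  rewrite (ae_eq_integral (EFin \o u)) //.
  - by rewrite -(fineK (integrable_fin_num _ iu))//; congr EFin.
  - exact: measurableT_comp.
  - by apply: filterS u0 => x /= u0 _; rewrite ger0_norm.
by apply: filterS => x /(_ Logic.I) [].
Qed.

Lemma ae_ge0_Rintegral u : mu.-integrable setT (EFin \o u) ->
  {ae mu, forall x, 0 <= u x} -> 0 <= \int[mu]_x u x.
Proof.
move=> iu u0; have /measurable_EFinP mu' := measurable_int _ iu.
rewrite (@ae_eq_Rintegral u (fun x => `|u x|)) => //.
- by apply: Rintegral_ge0 => x _.
- exact: measurableT_comp.
- by apply: filterS u0 => x u0; rewrite ger0_norm.
Qed.

(* [f] and [g] need not be measurable: a simple function below [f] stays below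
   [g], with the same integral, once it is set to [0] on [N]. *)
Lemma eq_integral_off_null (N : set T) (f g : T -> \bar R) :
  measurable N -> mu N = 0%E -> (forall x, ~ N x -> f x = g x) ->
  (\int[mu]_x f x = \int[mu]_x g x)%E.
Proof.
move=> mN N0.
have le_nn (f' g' : T -> \bar R) : (forall x, 0 <= f' x)%E ->
    (forall x, 0 <= g' x)%E -> (forall x, ~ N x -> f' x = g' x) ->
    (\int[mu]_x f' x <= \int[mu]_x g' x)%E.
  move=> f0 g0 fg; rewrite !ge0_integralTE//; apply: ge_ereal_sup.
  move=> _ [h /= hf <-].
  pose k : {nnsfun T >-> R} := proj_nnsfun h (measurableC mN).
  have -> : sintegral mu h = sintegral mu k.
    rewrite -!integralT_nnsfun; apply: ae_eq_integral => //.
    - exact/measurable_EFinP.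
    - exact/measurable_EFinP.
    - exists N; split => // x /= /not_implyP[_] xE; apply: contrapT => nNx.
      by apply: xE; rewrite /k/= mindicE mem_set// mulr1.
  apply: ereal_sup_ubound; exists k => //= x.
  rewrite /k/= mindicE; have [Nx|Nx] := pselect (N x).
    by rewrite memNset ?mulr0//; exact.
  by rewrite mem_set// mulr1 -fg.
move=> fg; rewrite [LHS]integralE [RHS]integralE; congr (_ - _)%E.
all: apply/eqP; rewrite eq_le !le_nn// => x Nx.
all: by rewrite !(funeposE, funenegE) fg.
Qed.

End almost_everywhere.

(** * Jensen's inequality and its equality case *)

Section jensen.
Context d (T : measurableType d) (R : realType).
Variables (mu : {measure set T -> \bar R}) (I : set R) (f : R -> R).
Hypothesis mu01 : (0 < mu setT < +oo)%E.
Hypothesis itvI : is_interval I.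
Hypothesis cvxf : convex_function I f.
(** [h] is a measurable version of the composite of [f] and [g], which may itself fail to be
    measurable where [g] leaves [I]. *)
Variables (g h : T -> R).
Hypothesis ig : mu.-integrable setT (EFin \o g).
Hypothesis ih : mu.-integrable setT (EFin \o h).
Hypothesis Ig : {ae mu, forall x, I (g x)}.
Hypothesis hfg : {ae mu, forall x, h x = f (g x)}.

Let mass := fine (mu setT).
Let m := mean mu g.

Let mass_gt0 : 0 < mass. Proof. exact: fine_gt0. Qed.

Let mg : measurable_fun setT g.
Proof. exact/measurable_EFinP/(measurable_int mu). Qed.

Let mh : measurable_fun setT h.
Proof. exact/measurable_EFinP/(measurable_int mu). Qed.

Let icst k : mu.-integrable setT (EFin \o cst k).
Proof.
apply/integrableP; split; first exact/measurable_EFinP.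
rewrite (_ : (fun x => _) = cst `|k|%:E)// integral_cst// lte_mul_pinfty//.
by case/andP: mu01.
Qed.

Let mean_cst k : mean mu (cst k) = k.
Proof. by rewrite /mean Rintegral_cst// mulrCA mulVf ?mulr1// gt_eqF. Qed.

Lemma mean_ae_cst k : {ae mu, forall x, g x = k} -> m = k.
Proof.
move=> gk; rewrite -[RHS]mean_cst /m /mean; congr (_ * _).
exact: ae_eq_Rintegral.
Qed.

Let integral_g : \int[mu]_x g x = m * mass.
Proof. by rewrite /m /mean mulrAC mulVf ?mul1r// gt_eqF. Qed.

Let integral_centered : \int[mu]_x (g x - m) = 0.
Proof.
by rewrite RintegralB//; [rewrite Rintegral_cst// integral_g subrr|exact: icst].
Qed.

Let icentered : mu.-integrable setT (EFin \o (fun x => g x - m)).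
Proof.
by apply: (integrableB measurableT ig (icst m)).
Qed.

Let eq_case : {ae mu, forall x, g x = m} -> f m = mean mu h.
Proof.
move=> gm; rewrite -[LHS]mean_cst /mean; congr (_ * _).
apply: ae_eq_Rintegral => //.
by apply: filterS2 hfg gm => x -> ->.
Qed.

(** If [I] had no point on the given side of [m], then [g - m] would have constant sign a.e.; its
    integral is 0, so it would vanish a.e. *)
Let side (sgn : bool) : ~ {ae mu, forall x, g x = m} ->
  exists2 x, I x & if sgn then x < m else m < x.
Proof.
move=> ngm; apply: contrapT => H; apply: ngm.
have le_ae : {ae mu, forall x, 0 <= (-1) ^+ (~~ sgn) * (g x - m)}.
  apply: filterS Ig => x Igx; rewrite leNgt; apply/negP => K; apply: H.
  exists (g x) => //; case: (sgn) K => K; rewrite /= ?expr0 ?expr1; lra.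
have := ae_eq0_Rintegral (integrableZl measurableT _ icentered) le_ae.
rewrite RintegralZl// integral_centered mulr0 => /(_ erefl).
apply: filterS => x /eqP; rewrite mulf_eq0 signr_eq0/= subr_eq0 => /eqP //.
Qed.

Let supporting : ~ {ae mu, forall x, g x = m} ->
  I m /\ exists a : R, forall t, I t -> f m + a * (t - m) <= f t.
Proof.
move=> ngm; have [x Ix /= xm] := side true ngm.
have [y Iy /= my] := side false ngm.
split; first by apply: (itvI Ix Iy); rewrite !ltW.
by apply: (convex_supporting_line itvI cvxf Ix Iy); rewrite xm.
Qed.

Let igap a : mu.-integrable setT
  (EFin \o (fun x => h x - (f m + a * (g x - m)))).
Proof.
have H := integrableD measurableT (icst (f m))
  (integrableZl measurableT a icentered).
by apply: (integrableB measurableT ih H).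
Qed.

(** The linear term of the line has integral 0, so only the defect in Jensen's inequality remains,
    whatever the slope. *)
Let integral_gap a :
  \int[mu]_x (h x - (f m + a * (g x - m))) = mass * (mean mu h - f m).
Proof.
rewrite RintegralB//; last first.
  exact: (integrableD measurableT (icst (f m))
    (integrableZl measurableT a icentered)).
rewrite RintegralD//; last first.
- exact: (integrableZl measurableT a icentered).
- exact: icst.
rewrite Rintegral_cst// RintegralZl// integral_centered mulr0 addr0.
by rewrite /mean mulrBr mulVKf ?gt_eqF// mulrC.
Qed.

Lemma jensen_ae : f m <= mean mu h.
Proof.
(* For constant [g], the point [m] may be an endpoint of [I] without a supporting line. *)
have [gm|ngm] := pselect {ae mu, forall x, g x = m}; first by rewrite eq_case.
have [_ [a fa]] := supporting ngm.
rewrite -subr_ge0 -(pmulr_rge0 _ mass_gt0) -(integral_gap a).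
apply: ae_ge0_Rintegral => //.
by apply: filterS2 hfg Ig => x -> Igx; rewrite subr_ge0; exact: fa.
Qed.

Lemma jensen_ae_strict : strictly_convex_function I f ->
  f m = mean mu h <-> exists k : R, {ae mu, forall x, g x = k}.
Proof.
move=> scf; split => [fmh|[k gk]]; last first.
  by apply: eq_case; rewrite (mean_ae_cst gk).
exists m; apply: contrapT => ngm.
have [Im [a fa]] := supporting ngm.
apply: ngm.
have gap0 : {ae mu, forall x, h x - (f m + a * (g x - m)) = 0}.
  apply: ae_eq0_Rintegral => //; last first.
    by rewrite integral_gap fmh subrr mulr0.
  by apply: filterS2 hfg Ig => x -> Igx; rewrite subr_ge0; exact: fa.
apply: filterS3 gap0 hfg Ig => x + hx Igx; rewrite {}hx => gap.
apply/eqP; apply/negPn/negP => gxm.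
(* The graph meets the line at [g x] and at [m], so strict convexity puts it below the line at their
   midpoint [z], a contradiction. *)
have half : 0 < (2^-1 : R) < 1 by lra.
have := scf _ _ _ Igx Im gxm half.
set z := (_ + _ : R).
have Iz : I z.
  have [xm|xm|xm] := ltgtP (g x) m; last by rewrite xm eqxx in gxm.
  - by apply: (itvI Igx Im); rewrite /z; lra.
  - by apply: (itvI Im Igx); rewrite /z; lra.
have := fa _ Iz.
have -> : a * (z - m) = 2^-1 * (a * (g x - m)) by rewrite /z; field.
lra.
Qed.

End jensen.

(** * Fubini's theorem for [delta] in the sigma-finite case *)

Section fubini.
Context d1 d2 (V : measurableType d1) (E : measurableType d2) (R : realType).
Variable mu : {sigma_finite_measure set V -> \bar R}.
Variable tau : {sigma_finite_measure set E -> \bar R}.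

Lemma Rintegral12_prod (K : V * E -> R) (F : V -> R) :
  (mu \x tau)%E.-integrable setT (EFin \o K) -> measurable_fun setT F ->
  {ae mu, forall v, F v = \int[tau]_e K (v, e)} ->
  mu.-integrable setT (EFin \o F) /\
  \int[mu]_v F v = \int[(mu \x tau)%E]_p K p.
Proof.
move=> iK mF FK; have iF := integrable_fubini_F iK.
have eqF : {ae mu, forall v, fubini_F tau (EFin \o K) v = (F v)%:E}.
  apply: filterS2 FK (integrable_ae measurableT iF) => v -> /(_ Logic.I) fv.
  by rewrite fineK.
have emF : measurable_fun setT (EFin \o F) by exact/measurable_EFinP.
split; first exact: (ae_eq_integrable iF emF eqF).
congr fine; rewrite -(integral12_prod_meas1 iK).
apply: ae_eq_integral => //.
- exact: (measurable_fubini_F iK).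
- by apply: filterS eqF => v -> _.
Qed.

Variables (M : V * E -> R) (w : E -> R) (c : R).
Hypothesis iw : tau.-integrable setT (EFin \o w).
Hypothesis iK : (mu \x tau)%E.-integrable setT
  (EFin \o (fun p => M p * w p.2)).

Local Notation delta := (delta tau M w).

Lemma measurable_delta : measurable_fun setT delta.
Proof.
have mF := measurable_fubini_F iK.
by apply: (measurableT_comp _ mF); exact: fine_measurable.
Qed.

Lemma integrable_delta : mu.-integrable setT (EFin \o delta).
Proof. by apply: (Rintegral12_prod iK measurable_delta _).1; exact: aeW. Qed.

Lemma integral_delta :
  {ae tau, forall e, (\int[mu]_v (M (v, e))%:E = c%:E)%E} ->
  \int[mu]_v delta v = c * \int[tau]_e w e.
Proof.
move=> Mc.
have [_ ->] : _ /\ \int[mu]_v delta v = _ :=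
  Rintegral12_prod iK measurable_delta (aeW _ (fun=> erefl)).
rewrite -RintegralZl//; congr fine; rewrite -(integral21_prod_meas1 iK).
apply: ae_eq_integral => //.
- exact: (measurable_fubini_G iK).
- by apply/measurable_EFinP/measurable_funM => //;
    exact/measurable_EFinP/(measurable_int tau).
apply: filterS2 Mc (ae_integrable2 iK) => e Mec iKe _.
(* Integrability of [M (v, e)] in [v] is obtained from that of [M (v, e) * w e] on division by
   [w e], so zeros of [w] are treated apart. *)
have [we0|we0] := eqVneq (w e) 0.
  rewrite we0 mulr0 /fubini_G -[RHS](@integral0 _ _ _ mu setT).
  by apply: eq_integral => v _ /=; rewrite we0 mulr0.
have iMe : mu.-integrable setT (fun v => (M (v, e))%:E).
  have := integrableZl measurableT (w e)^-1 iKe.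
  apply: eq_integrable => // v _ /=.
  by rewrite -EFinM mulrC mulfK.
rewrite EFinM -Mec muleC -integralZl//.
by apply: eq_integral => v _ /=; rewrite EFinM muleC.
Qed.

(** For fixed [v] the factor [psi (delta v)] leaves the inner integral, and what remains is
    [delta v]. *)
Lemma integral_comp_delta (psi : R -> R) :
  measurable_fun setT psi ->
  (mu \x tau)%E.-integrable setT
    (EFin \o (fun p => psi (delta p.1) * M p * w p.2)) ->
  mu.-integrable setT (EFin \o (fun v => delta v * psi (delta v))) /\
  \int[mu]_v (delta v * psi (delta v)) =
    \int[(mu \x tau)%E]_p (psi (delta p.1) * M p * w p.2).
Proof.
move=> mpsi ipsi; apply: Rintegral12_prod => //.
  apply: measurable_funM; first exact: measurable_delta.
  by apply: measurableT_comp => //; exact: measurable_delta.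
apply: filterS (ae_integrable1 iK) => v iKv /=.
rewrite mulrC -RintegralZl//.
by apply: eq_Rintegral => e _; rewrite mulrA.
Qed.

End fubini.

(** * Restriction of the measures to the support of the weight *)

(** Stated for arbitrary [f], since integrands containing [phi] may be non-measurable. *)
Lemma eq_measure_integral_support d (T : measurableType d) (R : realType)
    (m1 m2 : {measure set T -> \bar R}) (D : set T) (f : T -> \bar R) :
  (forall A, measurable A -> A `<=` D -> m1 A = m2 A) ->
  (forall x, ~ D x -> f x = 0%E) ->
  (\int[m1]_x f x = \int[m2]_x f x)%E.
Proof.
move=> m12 f0; have fD : f = f \_ D.
  apply/funext => x; rewrite patchE; case: ifPn => //.
  by move/negP; rewrite inE => /f0.
by rewrite fD -!integral_mkcond; exact: eq_measure_integral.
Qed.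

(** By Markov's inequality the sets where [|w|] is at least [1 / (n + 1)] have finite measure, and
    they exhaust [S]. The complement of [S] is null for the restricted measure. *)
Lemma sigma_finite_support d (T : measurableType d) (R : realType)
    (mu : {measure set T -> \bar R}) (w : T -> R) (S : set T)
    (mS : measurable S) :
  mu.-integrable setT (EFin \o w) -> S `<=` [set x | w x != 0] ->
  sigma_finite setT (mrestr mu mS).
Proof.
move=> iw Sw; have [mw wy] := integrableP _ _ _ iw.
pose A n := [set x | (n.+1%:R^-1%:E <= `|(w x)%:E|)%E].
have mA n : measurable (A n).
  rewrite -[A n]setTI; apply: emeasurable_fun_c_infty => //.
  exact: measurableT_comp.
exists (fun n => ~` S `|` A n).
  apply/seteqP; split => // x _.
  have [Sx|Sx] := pselect (S x); last by exists 0%N => //; left.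
  have w0 : 0 < `|w x| by rewrite normr_gt0; exact: Sw.
  have [n] := ltr_add_invr w0; rewrite add0r => nw.
  by exists n => //; right; rewrite /A/= lee_fin ltW.
move=> n; split; first by apply: measurableU => //; exact: measurableC.
apply: (@le_lt_trans _ _ (mu (A n))).
  rewrite /mrestr setIUl setICl set0U le_measure ?inE//.
  exact: measurableI.
have := le_integral_abse mu measurableT mw (a := n.+1%:R^-1).
rewrite setTI invr_gt0 ltr0n => /(_ isT) /le_lt_trans /(_ wy).
rewrite -/(A n); have := measure_ge0 mu (A n).
case: (mu (A n)) => [r _ _||]//=; first by rewrite ltry.
by move=> _; rewrite gt0_muley ?lte_fin ?invr_gt0.
Qed.

(** The restriction of [m] to the strip over [S] has the right values on rectangles, so uniqueness
    of sigma-finite products applies. *)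
Lemma product_measure_restr d1 d2 (V : measurableType d1)
    (E : measurableType d2) (R : realType)
    (mu : {sigma_finite_measure set V -> \bar R})
    (tau : {measure set E -> \bar R}) (S : set E) (mS : measurable S)
    (tauS : {sigma_finite_measure set E -> \bar R})
    (m : {measure set (V * E)%type -> \bar R}) (A : set (V * E)) :
  (forall B, tauS B = tau (B `&` S)) ->
  is_product_measure mu tau m -> measurable A -> A `<=` setT `*` S ->
  m A = (mu \x tauS)%E A.
Proof.
move=> tauSE mprod mA AS.
have mD : measurable ([set: V] `*` S) by exact: measurableX.
rewrite (@product_measure_unique _ _ _ _ _ mu tauS (mrestr m mD)) => //.
  by rewrite /= /mrestr setIidl.
move=> B C mB mC; rewrite /= /mrestr -setXI setIT mprod//; last first.
  exact: measurableI.
by rewrite tauSE.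
Qed.

(** * Reduction to the sigma-finite case and application of Jensen's inequality *)

Theorem corollary5p5 (R : realType) (d1 d2 : measure_display)
  (V : measurableType d1) (E : measurableType d2)
  (mu : {measure set V -> \bar R}) (tau : {measure set E -> \bar R})
  (mutau : {measure set (V * E)%type -> \bar R})
  (mutau_prod : is_product_measure mu tau mutau)
  (M : V * E -> R) (mM : measurable_fun [set: V * E] M)
  (wt : E -> R) (mwt : measurable_fun [set: E] wt)
  (I : set R) (itvI : is_interval I)
  (phi : R -> R)
  (cvxf : convex_function I (fun t : R => t * phi t))
  (E0 : set E) (mE0 : measurable E0)
  (c : R)
  (hi : (0 < mu [set: V] < +oo)%E)
  (hii : (0 < \int[tau]_(e in [set: E]) (erase E0 wt e)%:E < +oo)%E)
  (hiii : (\int[mutau]_(p in [set: V * E])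
             (`|M p| * `|erase E0 wt p.2|)%:E < +oo)%E)
  (hiv : {ae tau, forall e, (\int[mu]_(v in [set: V]) (M (v, e))%:E = c%:E)%E})
  (hv : {ae mu, forall v, I (delta tau M (erase E0 wt) v)})
  (hvi : (\int[mutau]_(p in [set: V * E])
            (`|phi (delta tau M (erase E0 wt) p.1)| *
             `|M p| * `|erase E0 wt p.2|)%:E < +oo)%E) :
  let wtE0 := erase E0 wt in
  let s := \int[tau]_(e in [set: E]) wtE0 e in
  let deltaE0 := delta tau M wtE0 in
  let lhs := s^-1 * \int[mutau]_(p in [set: V * E])
                      (phi (deltaE0 p.1) * M p * wtE0 p.2) in
  let rhs := c * phi (mean mu deltaE0) in
  (lhs >= rhs) /\
  (strictly_convex_function I (fun t : R => t * phi t) ->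
   (lhs = rhs <-> exists k : R, {ae mu, forall v, deltaE0 v = k})).
Proof.
move=> wtE0 s deltaE0 lhs rhs.
have mw : measurable_fun setT wtE0.
  have -> : wtE0 = wt \_ (~` E0).
    by apply/funext => e; rewrite /wtE0 /erase patchE in_setC; case: ifP.
  apply: (measurable_restrictT _ (measurableC mE0)).1.
  exact: measurable_funTS.
have iw : tau.-integrable setT (EFin \o wtE0).
  apply/integrableP; split; first exact/measurable_EFinP.
  (* Since [+oo - +oo] is [-oo], a finite integral of a signed measurable function already gives
     integrability. *)
  rewrite integral_fin_num_abs// fin_real//.
  by case/andP: hii => s0 ->; rewrite (lt_trans _ s0).
pose S := [set e | wtE0 e != 0].
have mS : measurable S.
  rewrite (_ : S = ~` (wtE0 @^-1` [set 0])); last first.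
    by apply/seteqP; split => e /=; [move/eqP|move=> ?; apply/eqP].
  by apply: measurableC; rewrite -[X in measurable X]setTI; exact: mw.
have wS e : ~ S e -> wtE0 e = 0 by move/negP; rewrite negbK => /eqP.
pose tauS : {sigma_finite_measure set E -> \bar R} :=
  HB.pack (mrestr tau mS) (Measure_isSigmaFinite.Build _ _ _ (mrestr tau mS)
    (sigma_finite_support mS iw (fun=> id))).
have mu_sf : sigma_finite setT mu.
  apply: fin_num_fun_sigma_finite; first by rewrite measure0.
  by apply: lty_fin_num_fun; case/andP: hi.
pose mu_sfinite := isSFinite.Build _ _ _ _ (sfinite_measure_sigma_finite mu_sf).
pose mu_sigma_finite := isSigmaFinite.Build _ _ _ _ mu_sf.
pose mu' := HB.pack_for (SigmaFiniteMeasure.type V R) (Measure.sort mu)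
  mu_sfinite mu_sigma_finite.
(* Every integrand below that involves [tau] or [mutau] carries the factor [wtE0], so it vanishes
   off [S] and the sigma-finite measures may be used instead. *)
have tauSE f : (forall e, ~ S e -> f e = 0%E) ->
    (\int[tau]_e f e = \int[tauS]_e f e)%E.
  apply: eq_measure_integral_support => A mA AS.
  by rewrite /= /mrestr setIidl.
have mutauE f : (forall p, ~ S p.2 -> f p = 0%E) ->
    (\int[mutau]_p f p = \int[(mu' \x tauS)%E]_p f p)%E.
  move=> f0; apply: (@eq_measure_integral_support _ _ _ _ _ (setT `*` S)).
    by move=> A mA AS; exact: (@product_measure_restr _ _ _ _ _ mu' tau S).
  by move=> p /= pS; apply: f0 => ?; exact: pS.
have deltaE : deltaE0 = delta tauS M wtE0.
  apply/funext => v; congr fine; apply: tauSE => e /wS ->.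
  by rewrite mulr0.
have iK : (mu' \x tauS)%E.-integrable setT (EFin \o (fun p => M p * wtE0 p.2)).
  apply/integrableP; split.
    apply/measurable_EFinP/measurable_funM => //.
    by apply: measurableT_comp => //; exact: measurable_snd.
  rewrite -mutauE => [|p /wS /= ->]; last by rewrite mulr0 normr0.
  by under eq_integral do rewrite /= normrM.
have iwS : tauS.-integrable setT (EFin \o wtE0).
  apply/integrableP; split; first exact/measurable_EFinP.
  rewrite -tauSE => [|e /wS /= ->]; last by rewrite normr0.
  exact: (integrableP _ _ _ iw).2.
have mI := is_interval_measurable itvI.
(* [psi] is measurable on the whole line and agrees with [phi] at [deltaE0 v] for [v] outside the
   null set [N]. *)
pose psi := phi \_ I.
have mpsi : measurable_fun setT psi.
  apply: (measurable_restrictT _ mI).1; apply: measurable_of_idM => //.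
  exact: convex_measurable.
have [N [mN N0 IN]] := hv.
have psiE v : ~ N v -> psi (deltaE0 v) = phi (deltaE0 v).
  move=> Nv; rewrite /psi patchE ifT// inE; apply: contrapT => nI.
  by apply: Nv; exact: IN.
(* This holds even if [tauS] has infinite mass, as [0 * +oo = 0]. *)
have NE0 : (mu' \x tauS)%E (N `*` setT) = 0%E.
  by rewrite product_measure1E//= N0 mul0e.
have mNE : measurable (N `*` [set: E]) by exact: measurableX.
have ipsi : (mu' \x tauS)%E.-integrable setT
    (EFin \o (fun p => psi (delta tauS M wtE0 p.1) * M p * wtE0 p.2)).
  apply/integrableP; split.
    apply/measurable_EFinP/measurable_funM => //; last first.
      by apply: measurableT_comp => //; exact: measurable_snd.
    apply: measurable_funM => //; apply: measurableT_comp => //.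
    apply: measurableT_comp; last exact: measurable_fst.
    exact: (measurable_delta iK).
  rewrite -deltaE (eq_integral_off_null mNE NE0 (g := fun p =>
    (`|phi (deltaE0 p.1)| * `|M p| * `|wtE0 p.2|)%:E)); last first.
    by move=> p Np; rewrite /= psiE ?normrM// => ?; exact: Np.
  by rewrite -mutauE// => p /wS ->; rewrite normr0 mulr0.
have [ih inth] := integral_comp_delta iK mpsi ipsi.
rewrite -deltaE in ih inth.
have [N' [mN' N'0 MN']] := hiv.
(* A null set of [tau] is null for its restriction. *)
have hivS : {ae tauS, forall e, (\int[mu']_v (M (v, e))%:E = c%:E)%E}.
  exists N'; split => //; apply/eqP; rewrite eq_le measure_ge0 andbT -N'0.
  by rewrite /= /mrestr le_measure// inE//; exact: measurableI.
have intdelta := integral_delta iwS iK hivS.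
have idelta := integrable_delta iK.
rewrite -deltaE in intdelta idelta.
have sE : \int[tauS]_e wtE0 e = s.
  by congr fine; rewrite -tauSE // => e /wS ->.
have s_gt0 : 0 < s by apply: fine_gt0.
pose m := mean mu deltaE0.
pose h v := deltaE0 v * psi (deltaE0 v).
pose mass := fine (mu setT).
have mass_gt0 : 0 < mass by apply: fine_gt0.
have hfd : {ae mu, forall v, h v = deltaE0 v * phi (deltaE0 v)}.
  exists N; split => // v; apply: contra_notP => Nv.
  by rewrite /= /h psiE.
have lhsE : lhs = s^-1 * mass * mean mu h.
  rewrite -mulrA /mean mulVKf ?gt_eqF//; congr (_ * _).
  rewrite -[RHS]/(\int[mu']_v h v) inth; congr fine.
  rewrite mutauE => [|p /wS ->]; last by rewrite mulr0.
  apply: (eq_integral_off_null mNE NE0) => p Np.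
  by rewrite psiE// => ?; exact: Np.
(* Here [m = c * s / mass], so the factor [m] in [m * phi m] cancels the scaling and leaves [c]. *)
have rhsE : rhs = s^-1 * mass * (m * phi m).
  have mE : m = mass^-1 * (c * s) by rewrite -sE -intdelta.
  rewrite {1}mE /rhs -/m; field.
  by rewrite !gt_eqF.
have k_gt0 : 0 < s^-1 * mass by rewrite mulr_gt0 ?invr_gt0.
have jensen := jensen_ae hi itvI cvxf idelta ih hv hfd.
have jensen_strict := jensen_ae_strict hi itvI cvxf idelta ih hv hfd.
rewrite lhsE rhsE; split; first by rewrite ler_pM2l.
move=> /jensen_strict <-; split => [/(mulfI (lt0r_neq0 k_gt0))|->] //.
Qed.
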